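(* There is no distance-regular graph with intersection array $\{55,36,11;1,4,45\}$. That is, there is no finite connected simple undirected graph $\Gamma$ of diameter $3$ such that, for every $i\in\{0,1,2,3\}$ and every pair of vertices $x,y$ of $\Gamma$ at distance $i$, the number of neighbours of $y$ at distance $i+1$ from $x$ equals $b_i$ and the number of neighbours of $y$ at distance $i-1$ from $x$ equals $c_i$, where $(b_0,b_1,b_2,b_3)=(55,36,11,0)$ and $(c_0,c_1,c_2,c_3)=(0,1,4,45)$.
   Context: Graphs are finite, undirected, without loops or multiple edges; distance is the usual path-length distance. A connected graph $\Gamma$ of diameter $d$ is called distance-regular with intersection array $\{b_0,b_1,\ldots,b_{d-1};c_1,c_2,\ldots,c_d\}$ if for every $i\in\{0,\ldots,d\}$ and every pair of vertices $x,y$ at distance $i$, there are exactly $b_i$ neighbours of $y$ at distance $i+1$ from $x$ and exactly $c_i$ neighbours of $y$ at distance $i-1$ from $x$ (with the conventions $b_d=0$ and $c_0=0$; necessarily $c_1=1$). In particular such a graph is regular of degree $b_0$. *)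

(* Defs.v *)
From mathcomp Require Import all_boot.

Set Implicit Arguments.
Unset Strict Implicit.
Unset Printing Implicit Defensive.

(* A finite simple undirected graph on T is given by its adjacency relation
   e : rel T, assumed symmetric and irreflexive. *)
Definition simple_graph (T : finType) (e : rel T) : Prop :=
  symmetric e /\ irreflexive e.

Definition connected_graph (T : finType) (e : rel T) : Prop :=
  forall x y : T, connect e x y.

Definition walk (T : finType) (e : rel T) (n : nat) (x y : T) : bool :=
  [exists p : n.-tuple T, path e x p && (last x p == y)].

(* The least length of a walk from x to y. A shortest walk has no repeated
   vertex, hence length < #|T|, so the bounded search finds it; the value is
   #|T| exactly when y is not reachable from x. *)
Definition dist (T : finType) (e : rel T) (x y : T) : nat :=
  find (fun n => walk e n x y) (iota 0 #|T|).

Definition diameter (T : finType) (e : rel T) : nat :=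
  \max_(x : T) \max_(y : T) dist e x y.

(* The intersection array {b_0,...,b_(d-1); c_1,...,c_d} is the pair of
   sequences b, c of length d. The default of nth gives b_d = 0, and prepending
   0 to c gives c_0 = 0 and shifts the indices to start from 1. The condition
   dist e x z = i - 1 is written (dist e x z).+1 = i, since the truncated
   subtraction would give i - 1 = 0 for i = 0. *)
Definition distance_regular (T : finType) (e : rel T) (b c : seq nat) : Prop :=
  [/\ connected_graph e,
      size b = diameter e,
      size c = diameter e &
      forall (i : nat) (x y : T), i <= diameter e -> dist e x y = i ->
        #|[set z | e y z & dist e x z == i.+1]| = nth 0 b i /\
        #|[set z | e y z & (dist e x z).+1 == i]| = nth 0 (0 :: c) i].

(* Main.v *)
Require Import Defs.
From mathcomp Require Import all_boot.
From mathcomp Require Import zify.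

(** In the local graph at a vertex (55 vertices, 18-regular, two non-adjacent
    vertices have at most c_2 - 1 = 3 common neighbours) closed neighbourhoods
    have 19 elements, so a 4-coclique would need 4 * 19 - 6 * 3 = 58 > 55
    vertices.  Hence if y, p, w is a coclique, the vertices adjacent to neither
    p nor w form a clique of size at least 55 - 2 * 19 = 17 containing y.  Two
    cliques of size at least 17 sharing a vertex share at least 15 of them, so
    their union is a clique; thus the maximal ones partition the local graph
    into cliques of sizes 17, 18 and 19.  Since 3 * 18 < 55 < 4 * 17, a
    19-clique occurs; it is a connected component, and a second one would leave
    only 17 vertices for an 18-regular graph.  So every vertex lies in exactly
    one 20-clique, and 20 divides the number of vertices,
    1 + 55 + 495 + 121 = 672, a contradiction. *)

Set Implicit Arguments.
Unset Strict Implicit.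
Unset Printing Implicit Defensive.

(** * Walks and path-length distance *)

Section Distance.

Variables (T : finType) (e : rel T).

Lemma walk0 x y : walk e 0 x y = (x == y).
Proof.
apply/existsP/idP => [[p]|xy]; first by rewrite tuple0.
by exists [tuple].
Qed.

Lemma walk1 x y : walk e 1 x y = e x y.
Proof.
apply/existsP/idP => [[p]|exy].
  by case: p => -[|a [|]] //= _; rewrite andbT => /andP[exa /eqP<-].
by exists [tuple y] => /=; rewrite exy eqxx.
Qed.

Lemma walk_rcons n x y z : walk e n x y -> e y z -> walk e n.+1 x z.
Proof.
case/existsP=> p /andP[pp /eqP lp] eyz.
apply/existsP; exists [tuple of rcons p z].
by rewrite /= rcons_path pp lp eyz last_rcons eqxx.
Qed.

Lemma dist_walk_le n x y : walk e n x y -> dist e x y <= n.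
Proof.
move=> w; case: (ltnP n #|T|) => [ltn|len]; last first.
  (* A failed search returns the length of the list, so the distance never exceeds [#|T|]. *)
  by apply: leq_trans len; rewrite -[leqRHS](size_iota 0) find_size.
rewrite leqNgt; apply/negP => /(before_find 0).
by rewrite nth_iota // add0n w.
Qed.

Hypothesis conn : connected_graph e.

(** A path given by connectedness shortens to one without repeated vertices, of length less than
    [#|T|]. The bounded search therefore succeeds and does not return its default. *)
Lemma walk_dist x y : walk e (dist e x y) x y.
Proof.
have hasw : has (fun n => walk e n x y) (iota 0 #|T|).
  have /connectP[p pp ->] := conn x y.
  case/shortenP: pp => q pq uq _.
  apply/hasP; exists (size q).
    rewrite mem_iota add0n /=.
    by have /card_uniqP /= <- := uq; apply: max_card.
  by apply/existsP; exists (in_tuple q); rewrite pq eqxx.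
have := nth_find 0 hasw.
by rewrite nth_iota ?add0n // -[ltnRHS](size_iota 0) -has_find.
Qed.

Lemma dist_eq0 x y : (dist e x y == 0) = (x == y).
Proof.
apply/idP/idP => [/eqP d0|xy]; first by have := walk_dist x y; rewrite d0 walk0.
by rewrite -leqn0 dist_walk_le ?walk0.
Qed.

Lemma dist_edge_le x y z : e y z -> dist e x z <= (dist e x y).+1.
Proof. by move=> eyz; apply/dist_walk_le/(walk_rcons (walk_dist x y)). Qed.

Lemma dist_eq1 x y : irreflexive e -> (dist e x y == 1) = e x y.
Proof.
move=> irr; apply/idP/idP => [/eqP d1|exy].
  by have := walk_dist x y; rewrite d1 walk1.
rewrite eqn_leq dist_walk_le ?walk1 //= lt0n dist_eq0.
by apply: contraTneq exy => ->; rewrite irr.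
Qed.

Lemma dist_diameter x y : dist e x y <= diameter e.
Proof.
apply: leq_trans (leq_bigmax (F := fun x => \max_y dist e x y) x).
exact: (leq_bigmax (F := fun y => dist e x y) y).
Qed.

End Distance.

(** * Double counting of edges and a union bound *)

Lemma sum_card_rel_exchange (T : finType) (e : rel T) (A B : {set T}) :
    symmetric e ->
  \sum_(y in A) #|[set z in B | e y z]| = \sum_(z in B) #|[set y in A | e z y]|.
Proof.
move=> sym.
have cardE (f : rel T) (C : {set T}) y :
    #|[set z in C | f y z]| = \sum_(z in C | f y z) 1.
  by rewrite -sum1_card; apply: eq_bigl => z; rewrite inE.
under eq_bigr do rewrite cardE.
rewrite /= (exchange_big_dep (mem B)) /=; last by move=> y z _ /andP[].
apply: eq_bigr => z zB; rewrite cardE; apply: eq_bigl => y.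
by rewrite zB sym.
Qed.

Lemma cardsU_leq (T : finType) (A B : {set T}) : #|A :|: B| <= #|A| + #|B|.
Proof. exact: (leq_card_setU A B).1. Qed.

(** * Large cliques in an abstract local graph *)

Section BigCliques.

Variables (T : finType) (r : rel T).
Hypothesis r_sym : symmetric r.

(** The case [x = y] is included: [r] stands for adjacency or equality, so that [ball y] is a closed
    neighbourhood. *)
Definition clique (K : {set T}) : bool := [forall x in K, forall y in K, r x y].

Lemma cliqueP (K : {set T}) : reflect {in K &, forall x y, r x y} (clique K).
Proof.
apply: (iffP forall_inP) => [cK x y xK yK|cK x xK].
  exact: (forall_inP (cK x xK)).
by apply/forall_inP => y; apply: cK.
Qed.

Variable D : {set T}.

Let ball y := [set z in D | r y z].

Hypotheses (card_D : #|D| = 55) (card_ball : {in D, forall y, #|ball y| = 19}).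
Hypothesis card_ballI :
  {in D &, forall y z, ~~ r y z -> #|ball y :&: ball z| <= 3}.

Lemma clique_sub_ball (K : {set T}) y :
  K \subset D -> clique K -> y \in K -> K \subset ball y.
Proof.
move=> /subsetP KD /cliqueP cK yK; apply/subsetP => z zK.
by rewrite inE KD //= cK.
Qed.

Lemma no_4coclique a b c d : a \in D -> b \in D -> c \in D -> d \in D ->
  ~~ r a b -> ~~ r a c -> ~~ r a d -> ~~ r b c -> ~~ r b d -> ~~ r c d -> False.
Proof.
move=> aD bD cD dD ab ac ad bc bd cd.
have ballD y : ball y \subset D by apply/subsetP => z /setIdP[].
have sub : (ball a :|: ball b :|: ball c) :|: ball d \subset D.
  by rewrite !subUset !ballD.
have := subset_leq_card sub; rewrite card_D.
(* Inclusion-exclusion, with each correction term split into pairwise intersections of size at most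
   3. *)
rewrite 3!cardsU !setIUl !card_ball //.
have := card_ballI aD bD ab; have := card_ballI aD cD ac.
have := card_ballI aD dD ad; have := card_ballI bD cD bc.
have := card_ballI bD dD bd; have := card_ballI cD dD cd.
have := cardsU_leq (ball a :&: ball c) (ball b :&: ball c).
have := cardsU_leq (ball a :&: ball d :|: ball b :&: ball d) (ball c :&: ball d).
have := cardsU_leq (ball a :&: ball d) (ball b :&: ball d).
lia.
Qed.

Definition big_clique (K : {set T}) : bool :=
  [&& K \subset D, clique K & 17 <= #|K|].

Lemma big_clique_cover y : y \in D -> exists2 K, big_clique K & y \in K.
Proof.
move=> yD.
have pick_out (A : {set T}) : #|A| < 55 -> exists2 p, p \in D & p \notin A.
  move=> ltA; have /set0Pn[p] : D :\: A != set0.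
    rewrite -card_gt0 cardsD.
    have := subset_leq_card (subsetIr D A); lia.
  by rewrite inE => /andP[]; exists p.
(* Since 19 and 19 + 19 are below 55, [p] and then [w] can be chosen so that [y], [p], [w] is a
   coclique. *)
have [|p pD npy] := pick_out (ball y); first by rewrite card_ball.
have [|w wD] := pick_out (ball y :|: ball p).
  have := cardsU_leq (ball y) (ball p); rewrite !card_ball //; lia.
rewrite !inE wD /= negb_or => /andP[nyw npw].
move: npy; rewrite inE pD /= => nyp.
exists (D :\: (ball p :|: ball w)); last first.
  by rewrite !inE yD /= ![r _ y]r_sym (negPf nyp) (negPf nyw).
rewrite /big_clique subsetDl /=; apply/andP; split.
  (* Unrelated [a] and [b] here would form a 4-coclique with [p] and [w]. *)
  apply/cliqueP => a b; rewrite !inE !negb_or.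
  case/andP=> [/andP[+ +] aD] /andP[/andP[+ +] bD]; rewrite aD bD /= => pa wa pb wb.
  apply/negP => /negP ab; exact: (no_4coclique pD wD aD bD npw pa pb wa wb ab).
rewrite cardsD card_D.
have := subset_leq_card (subsetIr D (ball p :|: ball w)).
have := cardsU_leq (ball p) (ball w); rewrite !card_ball //; lia.
Qed.

(** [K :|: L] lies in the ball of [v], so [K :&: L] has at least 17 + 17 - 19 = 15 elements. It also
    lies in the balls of both [x] and [y], which would share at most 3 elements if [x] and [y] were
    unrelated. *)
Lemma big_clique_rel (K L : {set T}) v x y : big_clique K -> big_clique L ->
  v \in K -> v \in L -> x \in K -> y \in L -> r x y.
Proof.
move=> /and3P[KD cK gK] /and3P[LD cL gL] vK vL xK yL.
apply/negPn/negP => nxy.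
have := card_ballI (subsetP KD x xK) (subsetP LD y yL) nxy.
have := subset_leq_card
  (setISS (clique_sub_ball KD cK xK) (clique_sub_ball LD cL yL)).
have : #|K :|: L| <= 19.
  rewrite -(card_ball (subsetP KD v vK)) subset_leq_card // subUset.
  by rewrite !clique_sub_ball.
rewrite cardsU; have := subset_leq_card (subsetIl K L); lia.
Qed.

(** The set [hull y] is the union of all big cliques through [y]. It turns out to be a big clique
    itself, and the hulls are the classes of [joined]. *)
Let joined y z := [exists K : {set T}, [&& big_clique K, y \in K & z \in K]].
Let hull y := [set z in D | joined y z].

Lemma big_clique_hull y : y \in D -> big_clique (hull y).
Proof.
move=> yD; apply/and3P; split; first by apply/subsetP => z /setIdP[].
  apply/cliqueP => a b; rewrite !inE.
  case/andP=> aD /existsP[K /and3P[bK yK aK]].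
  case/andP=> bD /existsP[L /and3P[bL yL bbL]].
  exact: big_clique_rel bK bL yK yL aK bbL.
have [K bK yK] := big_clique_cover yD.
have /and3P[KD _ gK] := bK.
apply: leq_trans gK (subset_leq_card _); apply/subsetP => z zK.
by rewrite inE (subsetP KD) //=; apply/existsP; exists K; rewrite bK yK zK.
Qed.

Lemma joined_equiv : {in D & &, equivalence_rel joined}.
Proof.
have refl y : y \in D -> joined y y.
  by move=> /big_clique_cover[K bK yK]; apply/existsP; exists K; rewrite bK yK.
have symm y z : joined y z -> joined z y.
  by case/existsP=> K /and3P[bK yK zK]; apply/existsP; exists K; rewrite bK yK zK.
have trans x y z : x \in D -> y \in D -> z \in D ->
    joined x y -> joined x z -> joined y z.
  move=> xD yD zD xy xz; apply/existsP; exists (hull x).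
  by rewrite big_clique_hull //= !inE yD zD xy xz.
move=> x y z xD yD zD; split=> [|xy]; first exact: refl.
by apply/idP/idP => [|yz]; [apply: trans | apply: (trans y)] => //; apply: symm.
Qed.

Lemma exists_19clique :
  exists K : {set T}, [/\ K \subset D, clique K & #|K| = 19].
Proof.
have [/existsP[K /and3P[KD cK /eqP]]|/existsPn no19] :=
  boolP [exists K : {set T}, [&& K \subset D, clique K & #|K| == 19]].
  by exists K.
exfalso.
(* The classes are hulls, of size at least 17; each lies in a ball of size 19, and size 19 is
   excluded by assumption. *)
have cardP A : A \in equivalence_partition joined D -> 17 <= #|A| <= 18.
  case/imsetP=> y yD ->; rewrite -/(hull y).
  have /and3P[hD ch gh] := big_clique_hull yD.
  have yh : y \in hull y.
    by rewrite inE yD; have [] := joined_equiv yD yD yD.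
  have := subset_leq_card (clique_sub_ball hD ch yh); rewrite card_ball //.
  have := no19 (hull y); rewrite hD ch /=; lia.
have cP := card_partition (equivalence_partitionP joined_equiv).
set P := equivalence_partition joined D in cardP cP.
(* The number of classes would be at most 3 by this bound and at least 4 by the next one. *)
have lo : #|P| * 17 <= 55.
  by rewrite -card_D cP -sum_nat_const leq_sum // => A /cardP /andP[].
have hi : 55 <= #|P| * 18.
  by rewrite -card_D cP -sum_nat_const leq_sum // => A /cardP /andP[].
lia.
Qed.

(** A clique lies in the ball of each of its vertices, and here the sizes agree. Hence no edge
    leaves a 19-clique. *)
Lemma clique19_ball (K : {set T}) y :
  K \subset D -> clique K -> #|K| = 19 -> y \in K -> K = ball y.
Proof.
move=> KD cK cardK yK; apply/eqP.
by rewrite eqEcard clique_sub_ball //= card_ball ?cardK ?(subsetP KD).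
Qed.

Lemma unique_19clique (K L : {set T}) :
  K \subset D -> clique K -> #|K| = 19 ->
  L \subset D -> clique L -> #|L| = 19 -> K = L.
Proof.
move=> KD cK cardK LD cL cardL.
have [disj|/pred0Pn[v /andP[vK vL]]] := boolP [disjoint K & L]; last first.
  by rewrite (clique19_ball KD cK cardK vK) (clique19_ball LD cL cardL vL).
exfalso.
have cardKL : #|K :|: L| = 38.
  by rewrite cardsU (disjoint_setI0 disj) cards0 cardK cardL.
have cardR : #|D :\: (K :|: L)| = 17.
  by rewrite cardsD (setIidPr _) ?subUset ?KD // card_D cardKL.
have /set0Pn[y] : D :\: (K :|: L) != set0 by rewrite -card_gt0 cardR.
rewrite !inE negb_or -andbA => /and3P[nyK nyL yD].
(* No edge leaves [K] or [L], so the ball of [y] has to fit into the 17 remaining vertices. *)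
have sub : ball y \subset D :\: (K :|: L).
  apply/subsetP => z; rewrite !inE => /andP[zD ryz]; rewrite zD andbT.
  rewrite negb_or; apply/andP; split.
    apply: contra nyK => zK; rewrite (clique19_ball KD cK cardK zK).
    by rewrite inE yD r_sym.
  apply: contra nyL => zL; rewrite (clique19_ball LD cL cardL zL).
  by rewrite inE yD r_sym.
by have := subset_leq_card sub; rewrite card_ball // cardR.
Qed.

End BigCliques.

(** * Counts from the intersection array *)

Section Array.

Variables (T : finType) (e : rel T).
Hypotheses (e_sym : symmetric e) (e_irr : irreflexive e).
Hypothesis dr : distance_regular e [:: 55; 36; 11] [:: 1; 4; 45].

Let conn : connected_graph e. Proof. by case: dr. Qed.
Let diam : diameter e = 3. Proof. by case: dr. Qed.

Lemma card_farther i x y : i <= 3 -> dist e x y = i ->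
  #|[set z | e y z & dist e x z == i.+1]| = nth 0 [:: 55; 36; 11] i.
Proof. by case: dr => _ _ _ H lei /H[]; rewrite ?diam. Qed.

Lemma card_closer i x y : i < 3 -> dist e x y = i.+1 ->
  #|[set z | e y z & dist e x z == i]| = nth 0 [:: 1; 4; 45] i.
Proof. by case: dr => _ _ _ H lei /H[]; rewrite ?diam. Qed.

Lemma card_neighbours x : #|[set z | e x z]| = 55.
Proof.
have /eqP d0 : dist e x x == 0 by rewrite dist_eq0.
have /= <- := card_farther (isT : 0 <= 3) d0; apply: eq_card => z.
by rewrite !inE dist_eq1 // andbb.
Qed.

Lemma card_triangles x y : e x y -> #|[set z | e x z & e y z]| = 18.
Proof.
move=> exy; have /eqP d1 : dist e x y == 1 by rewrite dist_eq1.
have := card_neighbours y.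
have /= := card_farther (isT : 1 <= 3) d1.
have /= := card_closer (isT : 0 < 3) d1.
(* The neighbours of [y] are split by their distance 0, 2 or 1 from [x]: 55 = 1 + 36 + 18. *)
rewrite -(cardsID [set z | dist e x z == 0] [set z | e y z]).
rewrite -(cardsID [set z | dist e x z == 2] ([set z | e y z] :\: _)).
set A := _ :&: _; set B := _ :&: _; set C := _ :\: _.
have -> : [set z | e y z & dist e x z == 0] = A.
  by apply/setP => z; rewrite !inE.
have -> : [set z | e y z & dist e x z == 2] = B.
  by apply/setP => z; rewrite !inE; case: eqP => [->|]; rewrite ?andbF.
have -> : [set z | e x z & e y z] = C.
  apply/setP => z; rewrite !inE -(dist_eq1 conn) //.
  case eyz: (e y z); rewrite ?andbF //= ?andbT.
  have := dist_edge_le conn x eyz; rewrite d1.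
  by case: (dist e x z) => [|[|[|]]].
lia.
Qed.

(** The common neighbour [x] puts [y] and [z] at distance 2, so the count is c_2. *)
Lemma card_common_neighbours x y z : e x y -> e x z -> y != z -> ~~ e y z ->
  #|[set w | e y w & e z w]| = 4.
Proof.
move=> exy exz nyz neyz.
have d2 : dist e y z = 2.
  have d1 : dist e y x == 1 by rewrite dist_eq1 // e_sym.
  have := dist_edge_le conn y exz; rewrite (eqP d1).
  move: nyz neyz; rewrite -(dist_eq0 conn) -(dist_eq1 conn) //.
  by case: (dist e y z) => [|[|[|]]].
have /= <- := card_closer (isT : 1 < 3) d2; apply: eq_card => w.
by rewrite !inE dist_eq1 // andbC.
Qed.

(** Double counting of the edges between consecutive layers. The second list starts at c_1, so its
    entry [i] is c_(i+1). *)
Lemma layer_recurrence x i : i < 3 ->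
  #|[set y | dist e x y == i]| * nth 0 [:: 55; 36; 11] i =
  #|[set y | dist e x y == i.+1]| * nth 0 [:: 1; 4; 45] i.
Proof.
move=> lti; rewrite -!sum_nat_const.
have := sum_card_rel_exchange [set y | dist e x y == i]
  [set y | dist e x y == i.+1] e_sym.
rewrite (eq_bigr (fun=> nth 0 [:: 55; 36; 11] i)) => [->|y]; last first.
  rewrite inE => /eqP dy; rewrite -(card_farther (ltnW lti) dy).
  by apply: eq_card => z; rewrite !inE andbC.
apply: eq_bigr => y; rewrite inE => /eqP dy; rewrite -(card_closer lti dy).
by apply: eq_card => z; rewrite !inE andbC.
Qed.

Lemma card_vertices (x : T) : #|T| = 672.
Proof.
have k0 : #|[set y | dist e x y == 0]| = 1.
  by rewrite -(cards1 x); apply: eq_card => y; rewrite !inE dist_eq0 // eq_sym.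
have := layer_recurrence x (isT : 0 < 3).
have := layer_recurrence x (isT : 1 < 3).
have := layer_recurrence x (isT : 2 < 3).
rewrite /= k0 => r2 r1 r0.
have dlt y : dist e x y < 4 by rewrite ltnS -diam dist_diameter.
(* The vertices are sorted by distance from [x]; the layer sizes are 1, 55, 55 * 36 / 4 = 495 and
   495 * 11 / 45 = 121. *)
rewrite -sum1_card (partition_big (fun y => Ordinal (dlt y)) predT) //=.
under eq_bigr => i _ do rewrite sum1dep_card.
rewrite !big_ord_recl big_ord0 /=.
have layerE (i : 'I_4) :
    #|[set y | Ordinal (dlt y) == i]| = #|[set y | dist e x y == i]|.
  by apply: eq_card => y; rewrite !inE -val_eqE.
rewrite !layerE /= /bump /= !addn0 !add1n.
lia.
Qed.

(** * The local graph at a vertex *)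

Let r := [rel x y | (x == y) || e x y].

Lemma adjeq_sym : symmetric r.
Proof. by move=> x y /=; rewrite eq_sym e_sym. Qed.

Lemma adjeq_refl : reflexive r.
Proof. by move=> x /=; rewrite eqxx. Qed.

Let nbhd x := [set z | e x z].

Lemma card_local_ball x :
  {in nbhd x, forall y, #|[set z in nbhd x | r y z]| = 19}.
Proof.
move=> y; rewrite inE => exy.
rewrite -(card_triangles exy) -[RHS]add1n.
rewrite (_ : [set z in _ | _] = y |: [set z | e x z & e y z]).
  by rewrite cardsU1 inE e_irr andbF.
apply/setP => z; rewrite !inE eq_sym.
by case: eqP => [->|_]; rewrite ?exy.
Qed.

Lemma card_local_ballI x : {in nbhd x &, forall y z, ~~ r y z ->
  #|[set w in nbhd x | r y w] :&: [set w in nbhd x | r z w]| <= 3}.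
Proof.
move=> y z; rewrite !inE => exy exz; rewrite negb_or => /andP[nyz neyz].
rewrite -ltnS -(card_common_neighbours exy exz nyz neyz).
apply/proper_card/properP; split.
  apply/subsetP => w; rewrite !inE => /andP[/andP[_ ryw] /andP[_ rzw]].
  case/predU1P: ryw => [yw|eyw]; last case/predU1P: rzw => [zw|ezw].
  - by move: rzw neyz nyz; rewrite -yw /= eq_sym e_sym => /orP[] ->.
  - by move: neyz; rewrite zw eyw.
  - by rewrite eyw ezw.
(* The vertex [x] is one of the 4 common neighbours but is outside its own neighbourhood, which
   leaves at most 3. *)
by exists x; rewrite !inE ?e_irr // !(e_sym _ x) exy exz.
Qed.

(** * The partition of the vertices into 20-cliques *)

Lemma clique20_cover x :
  exists K : {set T}, [/\ clique r K, #|K| = 20 & x \in K].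
Proof.
have [K [/subsetP KN /cliqueP cK cardK]] :=
  exists_19clique adjeq_sym (card_neighbours x)
    (@card_local_ball x) (@card_local_ballI x).
exists (x |: K); split; last exact: setU11.
  apply/cliqueP => a b /setU1P[->|aK] /setU1P[->|bK].
  - exact: adjeq_refl.
  - by have := KN b bK; rewrite inE /= => ->; rewrite orbT.
  - by have := KN a aK; rewrite inE /= e_sym => ->; rewrite orbT.
  - exact: cK.
rewrite cardsU1 cardK; case xK: (x \in K) => //.
by have := KN x xK; rewrite inE e_irr.
Qed.

(** Removing [x] from a 20-clique through [x] leaves a 19-clique of the local graph at [x], and that
    one is unique. *)
Lemma clique20_unique x (K L : {set T}) :
  clique r K -> #|K| = 20 -> clique r L -> #|L| = 20 ->
  x \in K -> x \in L -> K = L.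
Proof.
move=> cK cardK cL cardL xK xL.
have local (M : {set T}) : clique r M -> #|M| = 20 -> x \in M ->
    [/\ M :\ x \subset nbhd x, clique r (M :\ x) & #|M :\ x| = 19].
  move=> /cliqueP cM cardM xM; split.
  - apply/subsetP => z /setD1P[nzx zM]; rewrite inE.
    by have /= := cM x z xM zM; rewrite eq_sym (negPf nzx).
  - by apply/cliqueP => a b /setD1P[_ aM] /setD1P[_ bM]; apply: cM.
  - by move: cardM; rewrite (cardsD1 x) xM => -[].
have [K1 K2 K3] := local K cK cardK xK; have [L1 L2 L3] := local L cL cardL xL.
rewrite -(setD1K xK) -(setD1K xL); congr (_ |: _).
exact: (unique_19clique adjeq_sym (card_neighbours x) (@card_local_ball x)).
Qed.

Lemma dvdn20_card : 20 %| #|T|.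
Proof.
pose P := [set K : {set T} | clique r K & #|K| == 20].
have partP : partition P [set: T].
  apply/and3P; split.
  - rewrite eqEsubset subsetT; apply/subsetP => x _; apply/bigcupP.
    have [K [cK cardK xK]] := clique20_cover x.
    by exists K => //; rewrite inE cK cardK.
  - apply/trivIsetP => K L; rewrite !inE => /andP[cK /eqP cardK] /andP[cL /eqP cardL].
    apply: contraR => /pred0Pn[x /andP[xK xL]].
    exact/eqP/(clique20_unique cK cardK cL cardL xK xL).
  - by rewrite inE cards0 andbF.
rewrite -cardsT (card_uniform_partition (n := 20) _ partP) ?dvdn_mull //.
by move=> K; rewrite inE => /andP[_ /eqP].
Qed.

Lemma vertex_exists : exists x : T, true.
Proof.
case: (pickP (@predT T)) => [x _|T0]; first by exists x.
(* Over an empty type the maximum defining the diameter is 0, not 3. *)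
by have := diam; rewrite /diameter big_pred0.
Qed.

Lemma array_infeasible : False.
Proof. by have [x _] := vertex_exists; have := dvdn20_card; rewrite (card_vertices x). Qed.

End Array.

Theorem theorem1p4 (T : finType) (e : rel T) :
  simple_graph e ->
  ~ distance_regular e [:: 55; 36; 11] [:: 1; 4; 45].
Proof. by case=> sym irr /(array_infeasible sym irr). Qed.
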